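(* Let $0<\epsilon,\delta,\lambda<1$, $F=1-\epsilon$, $\nu=1-\lambda$, $k_+=\lceil\log_\lambda\delta\rceil$, $k_-=\lfloor\log_\lambda\delta\rfloor$, and for nonnegative integers $k$ define $$\tilde N(\epsilon,\delta,\lambda,k)=\frac{k\nu^2\delta F+\lambda^{k+1}+\lambda\delta(k\nu-1)}{\lambda\nu\delta\epsilon},\qquad \tilde N_\pm(\epsilon,\delta,\lambda)=\tilde N(\epsilon,\delta,\lambda,k_\pm).$$ Then $$N(\epsilon,\delta,\lambda)=\Big\lceil\min_{k\in\mathbb Z_{\ge0}}\tilde N(\epsilon,\delta,\lambda,k)\Big\rceil=\lceil\tilde N(\epsilon,\delta,\lambda,k^* )\rceil=\big\lceil\min\{\tilde N_+(\epsilon,\delta,\lambda),\tilde N_-(\epsilon,\delta,\lambda)\}\big\rceil=\begin{cases}\lceil\tilde N_-(\epsilon,\delta,\lambda)\rceil,&\delta\ge\frac{\lambda^{k_+}}{F+\lambda\epsilon},\\ \lceil\tilde N_+(\epsilon,\delta,\lambda)\rceil,&\delta\le\frac{\lambda^{k_+}}{F+\lambda\epsilon},\end{cases}$$ where $k^*$ is the largest integer $k$ satisfying $\delta\le\lambda^k/(F\nu+\lambda)=\lambda^k/(F+\lambda\epsilon)$, and $k^*$ is equal to either $k_+$ or $k_-$.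
   Context: Let $\mathcal H$ be a Hilbert space of finite dimension $D\ge 2$ and $|\Psi\rangle\in\mathcal H$ a unit vector. For $0\le\lambda<1$ let $\Omega_\lambda=|\Psi\rangle\langle\Psi|+\lambda(1-|\Psi\rangle\langle\Psi|)$. For an integer $N\ge1$ and a density operator $\rho$ on $\mathcal H^{\otimes(N+1)}$ put $p_\rho=\mathrm{tr}[(\Omega_\lambda^{\otimes N}\otimes 1)\rho]$ and $f_\rho=\mathrm{tr}[(\Omega_\lambda^{\otimes N}\otimes|\Psi\rangle\langle\Psi|)\rho]$. Define $F(N,\delta,\lambda)=\min\{f_\rho/p_\rho: p_\rho\ge\delta\}$ for $0<\delta\le1$, the minimum over permutation-invariant density operators on $\mathcal H^{\otimes(N+1)}$, and for $0<\epsilon,\delta<1$ let $N(\epsilon,\delta,\lambda)=\min\{N\ge1: F(N,\delta,\lambda)\ge1-\epsilon\}$ (the minimum number of tests needed to verify $|\Psi\rangle$ within infidelity $\epsilon$ and significance level $\delta$ in the adversarial scenario). *)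

(* Defs.v *)
From HB Require Import structures.
From mathcomp Require Import all_boot all_order all_algebra.
From mathcomp Require Import fingroup perm.
From mathcomp Require Import complex.
From mathcomp Require Import boolp classical_sets reals exp.
Set Implicit Arguments. Unset Strict Implicit. Unset Printing Implicit Defensive.
Import Order.TTheory GRing.Theory Num.Theory.
Local Open Scope ring_scope.

Section Verification.
Variable R : realType.
Local Notation C := R[i].
Variable D : nat.

Definition adj m n (A : 'M[C]_(m, n)) : 'M[C]_(n, m) := (map_mx Num.conj A)^T.

Definition psd m (A : 'M[C]_m) : Prop :=
  A = adj A /\ forall v : 'cV[C]_m, 0 <= (adj v *m A *m v) 0 0.

Definition density m (rho : 'M[C]_m) : Prop := psd rho /\ \tr rho = 1.

Definition unit_vec (Psi : 'cV[C]_D) : Prop := (adj Psi *m Psi) 0 0 = 1.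

Definition proj (Psi : 'cV[C]_D) : 'M[C]_D := Psi *m adj Psi.

Definition Omega (Psi : 'cV[C]_D) (lam : R) : 'M[C]_D :=
  proj Psi + (Complex lam 0) *: (1%:M - proj Psi).

(* computational basis of H^{(x)n}: tuples of basis indices *)
Definition tidx (n : nat) := {ffun 'I_n -> 'I_D}.

Definition tens n (A : 'I_n -> 'M[C]_D) : 'M[C]_#|{: tidx n}| :=
  \matrix_(i, j) \prod_(k < n) A k ((enum_val i : tidx n) k) ((enum_val j : tidx n) k).

Definition permop n (s : 'S_n) : 'M[C]_#|{: tidx n}| :=
  \matrix_(i, j) (((enum_val i : tidx n) == [ffun k => (enum_val j : tidx n) (s k)])%:R).

Definition perm_invariant n (rho : 'M[C]_#|{: tidx n}|) : Prop :=
  forall s : 'S_n, permop s *m rho = rho *m permop s.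

Definition p_val (Psi : 'cV[C]_D) (lam : R) (N : nat)
  (rho : 'M[C]_#|{: tidx N.+1}|) : R :=
  complex.Re (\tr (tens (fun k : 'I_N.+1 =>
        if (k < N)%N then Omega Psi lam else 1%:M) *m rho)).

Definition f_val (Psi : 'cV[C]_D) (lam : R) (N : nat)
  (rho : 'M[C]_#|{: tidx N.+1}|) : R :=
  complex.Re (\tr (tens (fun k : 'I_N.+1 =>
        if (k < N)%N then Omega Psi lam else proj Psi) *m rho)).

(* F(N, delta, lambda): min (= inf, attained) of f/p over permutation-invariant
   states with p >= delta *)
Definition Fmin (Psi : 'cV[C]_D) (N : nat) (del lam : R) : R :=
  inf [set f_val Psi lam rho / p_val Psi lam rho |
        rho in [set rho : 'M[C]_#|{: tidx N.+1}| |
                density rho /\ perm_invariant rho /\ del <= p_val Psi lam rho]].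

(* N(eps, delta, lambda) = min {N >= 1 : F(N,delta,lambda) >= 1 - eps}
   (0 by convention if no such N exists) *)
Definition Ntests (Psi : 'cV[C]_D) (eps del lam : R) : nat :=
  let P := fun N : nat => (1 <= N)%N && (1 - eps <= Fmin Psi N del lam) in
  match pselect (exists N, P N) with
  | left h => ex_minn h
  | right _ => 0%N
  end.

End Verification.

Definition Ntil (R : realType) (eps del lam : R) (k : int) : R :=
  let F := 1 - eps in let nu := 1 - lam in
  (k%:~R * nu ^+ 2 * del * F + lam ^ (k + 1) + lam * del * (k%:~R * nu - 1))
  / (lam * nu * del * eps).

Definition kplus (R : realType) (del lam : R) : int := Num.ceil (ln del / ln lam).
Definition kminus (R : realType) (del lam : R) : int := Num.floor (ln del / ln lam).

(* Main.v *)
(* Write P for the projector on Psi and Q = 1 - P.  Only the weights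
   w_j = tr[Pi_j rho] matter, where Pi_j sums the tensor products of N + 1
   factors P, Q with exactly j factors Q: averaging over the position of the
   last party, (N+1) p = sum_j w_j lam^j (N+1-j + j/lam) and
   (N+1) f = sum_j w_j lam^j (N+1-j).  Every distribution (w_j) occurs, so the
   states fill the convex hull of the level points (p_j, f_j), j <= N+1.
   F(N) >= F = 1 - eps says that f - F p >= 0 on the part p >= del of this hull.
   Bernoulli's inequality shows that all level points lie above the line
   through the levels k and k+1, and this line is nonnegative at p = del
   exactly when N >= Ntil k.  Hence one k with N >= Ntil k suffices (the line
   is a dual certificate); conversely the mixture of the two consecutive
   levels enclosing p = del yields such a k.  Finally Ntil k - Ntil (k-1) has
   the sign of del - lam^k / (F + lam eps), which locates the minimum. *)
Require Import Defs.
From HB Require Import structures.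
From mathcomp Require Import all_boot all_order all_algebra.
From mathcomp Require Import fingroup perm.
From mathcomp Require Import complex.
From mathcomp Require Import boolp classical_sets reals exp.
From mathcomp Require Import ring lra.
Import Order.TTheory GRing.Theory Num.Theory.
Local Open Scope ring_scope.
Local Open Scope classical_set_scope.

(** * Tensor products of local operators, and permutations of the factors *)

Section Tensor.
Context {R : realType} {D : nat}.
Local Notation C := R[i].

(** Passing from matrix indices to functions lets [bigA_distr_bigA] exchange a product over the
    factors with a sum over the basis. *)
Lemma sum_tidx {n} (F : tidx D n -> C) :
  \sum_(i < #|{: tidx D n}|) F (enum_val i) = \sum_f F f.
Proof.
rewrite [RHS](reindex (fun i : 'I_#|{: tidx D n}| => enum_val i)) //=.
exact/onW_bij/enum_val_bij.
Qed.

Lemma eq_tens {n} (A B : 'I_n -> 'M[C]_D) : A =1 B -> tens A = tens B.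
Proof.
move=> eqAB; apply/matrixP=> i j; rewrite !mxE.
by apply: eq_bigr => k _; rewrite eqAB.
Qed.

Lemma mul_tens {n} (A B : 'I_n -> 'M[C]_D) :
  tens A *m tens B = tens (fun k => A k *m B k).
Proof.
apply/matrixP=> i j; rewrite !mxE.
under eq_bigr do rewrite !mxE -big_split /=.
rewrite (sum_tidx (fun f => \prod_k (A k ((enum_val i : tidx D n) k) (f k) *
  B k (f k) ((enum_val j : tidx D n) k)))).
by under [RHS]eq_bigr do rewrite mxE; rewrite bigA_distr_bigA.
Qed.

Lemma adj_tens {n} (A : 'I_n -> 'M[C]_D) : adj (tens A) = tens (fun k => adj (A k)).
Proof.
apply/matrixP=> i j; rewrite !mxE rmorph_prod.
by apply: eq_bigr => k _; rewrite /adj !mxE.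
Qed.

Lemma tr_tens {n} (A : 'I_n -> 'M[C]_D) : \tr (tens A) = \prod_k \tr (A k).
Proof.
rewrite /mxtrace; under [LHS]eq_bigr do rewrite mxE.
rewrite (sum_tidx (fun f => \prod_k (A k (f k) (f k)))).
by rewrite bigA_distr_bigA.
Qed.

Lemma tens_distr {n} (c : 'I_n -> bool -> C) (B : bool -> 'M[C]_D) :
  tens (fun k => \sum_b c k b *: B b) =
  \sum_(f : {ffun 'I_n -> bool}) (\prod_k c k (f k)) *: tens (fun k => B (f k)).
Proof.
apply/matrixP=> i j; rewrite summxE !mxE.
transitivity (\prod_k \sum_b (c k b * B b ((enum_val i : tidx D n) k)
  ((enum_val j : tidx D n) k))).
  by apply: eq_bigr => k _; rewrite summxE; apply: eq_bigr => b _; rewrite mxE.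
by rewrite bigA_distr_bigA; apply: eq_bigr => f _; rewrite !mxE -big_split.
Qed.

Lemma permop_tens {n} (s : 'S_n) (A : 'I_n -> 'M[C]_D) :
  permop R D s *m tens A = tens (fun k => A (s k)) *m permop R D s.
Proof.
apply/matrixP=> i j; rewrite !mxE.
under eq_bigr do rewrite !mxE; under [RHS]eq_bigr do rewrite !mxE.
rewrite (sum_tidx (fun f => ((enum_val i : tidx D n) == [ffun k => f (s k)])%:R *
   \prod_k A k (f k) ((enum_val j : tidx D n) k))).
rewrite (sum_tidx (fun f => (\prod_k A (s k) ((enum_val i : tidx D n) k) (f k)) *
   (f == [ffun k => (enum_val j : tidx D n) (s k)])%:R)).
move: (enum_val i) (enum_val j) => f g /=.
(* Each matrix product has a single surviving summand: the permuted row index [f] on the left, the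
   permuted column index [g] on the right. *)
rewrite (bigD1 [ffun k => f (s^-1%g k)]) //= [X in _ + X = _]big1 => [|h neq]; last first.
  have [eqf|] := eqVneq f [ffun k => h (s k)]; last by rewrite mul0r.
  by case/eqP: neq; apply/ffunP=> k; rewrite eqf !ffunE permKV.
rewrite [RHS](bigD1 [ffun k => g (s k)]) //= [X in _ = _ + X]big1 => [|h /negPf->];
  last by rewrite mulr0.
rewrite eqxx mulr1 !addr0 [_ == _](_ : _ = true) ?mul1r; last first.
  by apply/eqP/ffunP=> k; rewrite !ffunE permK.
rewrite (reindex_inj (@perm_inj _ s)) /=.
by apply: eq_bigr => k _; rewrite !ffunE permK.
Qed.

Lemma permopV {n} (s : 'S_n) : permop R D s *m permop R D s^-1 = 1%:M.
Proof.
apply/matrixP=> i j; rewrite !mxE.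
under eq_bigr do rewrite !mxE.
rewrite (sum_tidx (fun f => ((enum_val i : tidx D n) == [ffun k => f (s k)])%:R *
   (f == [ffun k => (enum_val j : tidx D n) (s^-1%g k)])%:R)).
rewrite -(inj_eq enum_val_inj).
move: (enum_val i) (enum_val j) => f g /=.
rewrite (bigD1 [ffun k => g (s^-1%g k)]) //= [X in _ + X]big1 => [|h /negPf->];
  last by rewrite mulr0.
rewrite eqxx mulr1 addr0; congr ((_ == _)%:R).
by apply/ffunP=> k; rewrite !ffunE permK.
Qed.

(** Conjugation by [permop s] permutes the tensor factors; cyclicity of the trace absorbs it because
    [rho] commutes with it. *)
Lemma tr_tens_perm {n} (s : 'S_n) (A : 'I_n -> 'M[C]_D) rho :
  perm_invariant rho ->
  \tr (tens (fun k => A (s k)) *m rho) = \tr (tens A *m rho).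
Proof.
move=> inv_rho.
have VP : permop R D s^-1 *m permop R D s = 1%:M by rewrite -{2}[s]invgK permopV.
rewrite -{1}[rho]mul1mx -(permopV s) !mulmxA -permop_tens -!mulmxA mxtrace_mulC.
by rewrite -!mulmxA -inv_rho (mulmxA (permop R D s^-1)) VP mul1mx.
Qed.

End Tensor.

(** * Weights of the outcome patterns when every factor is measured with P and 1 - P *)

Section Weights.
Context {R : realType} {D : nat} (Psi : 'cV[R[i]]_D).
Hypothesis Psi1 : unit_vec Psi.
Local Notation C := R[i].
Local Notation "c %:C" := (real_complex R c) : ring_scope.

Lemma Re_sum (I : finType) (F : I -> C) :
  complex.Re (\sum_i F i) = \sum_i complex.Re (F i).
Proof. by apply: (big_morph (@complex.Re R)) => // -[a b] [c d]. Qed.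

Lemma ReZ (c : R) (z : C) : complex.Re (c%:C * z) = c * complex.Re z.
Proof. by case: z => a b /=; rewrite mul0r subr0. Qed.

Lemma adjM m n p (A : 'M[C]_(m, n)) (B : 'M[C]_(n, p)) :
  adj (A *m B) = adj B *m adj A.
Proof. by rewrite /adj map_mxM trmx_mul. Qed.

Lemma adjK m n (A : 'M[C]_(m, n)) : adj (adj A) = A.
Proof. by apply/matrixP=> i j; rewrite !mxE conjCK. Qed.

Lemma adjZ m n (c : R) (A : 'M[C]_(m, n)) : adj (c%:C *: A) = c%:C *: adj A.
Proof. by apply/matrixP=> i j; rewrite !mxE rmorphM /= /Num.conj /= oppr0. Qed.

(* [true] marks the tensor factors orthogonal to [Psi]. *)
Definition local_proj (b : bool) : 'M[C]_D := if b then 1%:M - proj Psi else proj Psi.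

Lemma projM : proj Psi *m proj Psi = proj Psi.
Proof.
rewrite /proj -mulmxA (mulmxA (adj Psi)) (mx11_scalar (adj Psi *m Psi)) Psi1.
by rewrite mul1mx.
Qed.

Lemma local_projM b c :
  local_proj b *m local_proj c = if b == c then local_proj b else 0.
Proof.
by case: b c => [] [] /=; rewrite ?mulmxBl ?mulmxBr ?mul1mx ?mulmx1 projM ?subrr ?subr0.
Qed.

Lemma adj_proj : adj (proj Psi) = proj Psi.
Proof. by rewrite /proj adjM adjK. Qed.

Lemma adj_local_proj b : adj (local_proj b) = local_proj b.
Proof.
case: b => /=; last exact: adj_proj.
by rewrite -[in RHS]adj_proj /adj map_mxB map_mx1 linearB /= trmx1.
Qed.

Lemma tr_local_proj b : \tr (local_proj b) = if b then D%:R - 1 else 1.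
Proof.
have trP : \tr (proj Psi) = 1.
  by rewrite /proj mxtrace_mulC (mx11_scalar (adj Psi *m Psi)) Psi1 mxtrace1.
by case: b; rewrite /= ?linearB /= ?mxtrace1 trP.
Qed.

Section Patterns.
Context {n : nat}.
Implicit Types (f g : {ffun 'I_n -> bool}) (rho : 'M[C]_#|{: tidx D n}|).

Definition pattern_proj f := tens (fun k => local_proj (f k)).
(** For a density operator this is the probability of the outcome pattern [f]. *)
Definition weight rho f : R := complex.Re (\tr (pattern_proj f *m rho)).

Lemma pattern_projM f : pattern_proj f *m pattern_proj f = pattern_proj f.
Proof. by rewrite mul_tens; apply: eq_tens => k; rewrite local_projM eqxx. Qed.

Lemma adj_pattern_proj f : adj (pattern_proj f) = pattern_proj f.
Proof. by rewrite adj_tens; apply: eq_tens => k; rewrite adj_local_proj. Qed.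

Lemma tr_pattern_projM f g :
  \tr (pattern_proj f *m pattern_proj g) =
  if f == g then \tr (pattern_proj f) else 0.
Proof.
case: eqVneq => [<-|neq]; first by rewrite pattern_projM.
rewrite mul_tens tr_tens.
have [k nefg] : exists k, f k != g k.
  apply/existsP; apply: contraNT neq; rewrite negb_exists => /forallP eqfg.
  by apply/eqP/ffunP=> k; apply/eqP; rewrite -[_ == _]negbK.
by rewrite (bigD1 k) //= local_projM (negPf nefg) linear0 mul0r.
Qed.

Lemma psd_pattern_proj f : psd (pattern_proj f).
Proof.
split=> [|v]; first by rewrite adj_pattern_proj.
rewrite -pattern_projM -{1}adj_pattern_proj !mulmxA -adjM -mulmxA mxE.
by apply: sumr_ge0 => i _; rewrite !mxE mulrC -normCK exprn_ge0.
Qed.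

Lemma weight_ge0 rho f : psd rho -> 0 <= weight rho f.
Proof.
case=> _ rho_ge0; suff: 0 <= \tr (pattern_proj f *m rho) by rewrite lecE => /andP[].
rewrite -pattern_projM -mulmxA mxtrace_mulC -{2}adj_pattern_proj.
apply: sumr_ge0 => i _; have := rho_ge0 (adj (row i (pattern_proj f))).
rewrite adjK; congr (0 <= _); rewrite -!row_mul !mxE.
by apply: eq_bigr => j _; rewrite !mxE.
Qed.

Lemma weight_perm rho f (s : 'S_n) : perm_invariant rho ->
  weight rho [ffun k => f (s k)] = weight rho f.
Proof.
move=> inv_rho; rewrite /weight -[in RHS](tr_tens_perm s) //.
by congr (complex.Re (\tr (_ *m _))); apply: eq_tens => k; rewrite ffunE.
Qed.

(** Operators diagonal in P and 1 - P on every factor see [rho] only through its weights; this one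
    expansion serves for p, f and the trace of [rho]. *)
Lemma tr_tens_weight (d : 'I_n -> R) rho :
  complex.Re (\tr (tens (fun k => proj Psi + (d k)%:C *: (1%:M - proj Psi)) *m rho)) =
  \sum_(f : {ffun 'I_n -> bool}) (\prod_k if f k then d k else 1) * weight rho f.
Proof.
rewrite (@eq_tens _ _ _ _ (fun k => \sum_b (if b then d k else 1)%:C *: local_proj b));
  last by move=> k; rewrite big_bool /= scale1r addrC.
rewrite (tens_distr (fun k b => (if b then d k else 1)%:C)) mulmx_suml [\tr _]linear_sum Re_sum.
apply: eq_bigr => f _; rewrite -scalemxAl linearZ /= -rmorph_prod ReZ.
by rewrite /weight.
Qed.

Lemma sum_weight rho : \tr rho = 1 -> \sum_f weight rho f = 1.
Proof.
move=> tr_rho; have := tr_tens_weight (fun=> 1) rho.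
rewrite (_ : tens _ = 1%:M) ?mul1mx ?tr_rho => [Re1|].
  transitivity (complex.Re (1 : C)) => //; rewrite Re1.
  by apply: eq_bigr => f _; rewrite big1 ?mul1r // => k _; rewrite if_same.
apply/matrixP=> i j; rewrite !mxE -(inj_eq enum_val_inj).
have -> : 1%:C = 1 by [].
under eq_bigr do rewrite scale1r addrC subrK mxE.
have [<-|neq] := eqVneq; first by rewrite big1 // => k _; rewrite eqxx.
have [k nek] : exists k, (enum_val i : tidx D n) k != (enum_val j : tidx D n) k.
  apply/existsP; apply: contraNT neq; rewrite negb_exists => /forallP eqij.
  by apply/eqP/ffunP=> k; apply/eqP; rewrite -[_ == _]negbK.
by rewrite (bigD1 k) //= (negPf nek) mul0r.
Qed.

End Patterns.
End Weights.

(** * Acceptance as a function of the number of factors orthogonal to [Psi], and states with any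
    prescribed level distribution *)

Section Levels.
Context {R : realType} {D : nat} (Psi : 'cV[R[i]]_D).
Hypothesis Psi1 : unit_vec Psi.
Context {N : nat} (lam : R).
Hypothesis lam_neq0 : lam != 0.
Local Notation C := R[i].
Local Notation "c %:C" := (real_complex R c) : ring_scope.
Local Notation pat := {ffun 'I_N.+1 -> bool}.
Implicit Types (c : R) (rho : 'M[C]_#|{: tidx D N.+1}|).

Definition wt (f : pat) : nat := \sum_k f k.

(* [c = 1] gives [p_val] and [c = 0] gives [f_val]. *)
Definition accept c rho : R :=
  complex.Re (\tr (tens (fun k : 'I_N.+1 =>
    if (k < N)%N then Omega Psi lam else proj Psi + c%:C *: (1%:M - proj Psi)) *m rho)).

Lemma p_valE rho : p_val Psi lam rho = accept 1 rho.
Proof.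
congr (complex.Re (\tr (_ *m _))); apply: eq_tens => k.
by rewrite scale1r addrC subrK.
Qed.

Lemma f_valE rho : f_val Psi lam rho = accept 0 rho.
Proof.
congr (complex.Re (\tr (_ *m _))); apply: eq_tens => k.
by rewrite scale0r addr0.
Qed.

(* [N.+1] times the value of [accept c] on a state of level [j]. *)
Definition level c (j : nat) : R := lam ^+ j * (N.+1%:R - j%:R + j%:R * (c / lam)).

Lemma wt_le f : (wt f <= N.+1)%N.
Proof.
rewrite -[N.+1]card_ord -sum1_card; apply: leq_sum => k _; exact: leq_b1.
Qed.

Lemma wt_perm (s : 'S_N.+1) (f : pat) : wt [ffun k => f (s k)] = wt f.
Proof.
by rewrite /wt [RHS](reindex_inj (@perm_inj _ s)); apply: eq_bigr => k _; rewrite ffunE.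
Qed.

(** By symmetry the untested party may sit at any position; summing over all [N.+1] positions leaves
    only the number of marked factors. *)
Lemma accept_avg c rho : perm_invariant rho ->
  N.+1%:R * accept c rho = \sum_f weight Psi rho f * level c (wt f).
Proof.
move=> inv_rho.
pose d (k : 'I_N.+1) := if k == ord_max then c else lam.
have acceptE : accept c rho =
    \sum_(f : pat) (\prod_k if f k then d k else 1) * weight Psi rho f.
  rewrite -tr_tens_weight; congr (complex.Re (\tr (_ *m _))); apply: eq_tens => k.
  by rewrite /d -val_eqE /= ltn_neqAle -ltnS ltn_ord andbT; case: eqP.
(* A transposition moves the last party to [k0]. Every marked factor is first counted as [lam], and
   [c / lam] corrects the one at [k0]. *)
have acceptE_at k0 : accept c rho =
    \sum_(f : pat) weight Psi rho f *
      (lam ^+ wt f * (1 - (f k0)%:R + (f k0)%:R * (c / lam))).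
  pose t := tperm k0 ord_max.
  have inj_t : injective (fun f : pat => [ffun k => f (t k)] : pat).
    by move=> f g /ffunP eqfg; apply/ffunP=> k; have := eqfg (t k); rewrite !ffunE tpermK.
  rewrite acceptE (reindex_inj inj_t) /=; apply: eq_bigr => f _.
  rewrite weight_perm // mulrC; congr (_ * _).
  rewrite (reindex_inj (@perm_inj _ t)) /=.
  rewrite (eq_bigr (fun k => if f k then (if k == k0 then c else lam) else 1)); last first.
    by move=> k _; rewrite ffunE tpermK /d (canF_eq (tpermK k0 ord_max)) tpermR.
  rewrite (bigD1 k0) //= eqxx /wt [in RHS](bigD1 k0) //=.
  rewrite (eq_bigr (fun k => lam ^+ f k)); last first.
    by move=> k /negPf ->; case: (f k).
  rewrite prodrXr exprD.
  by case: (f k0); rewrite /= ?expr1 ?expr0; field.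
transitivity (\sum_(k0 < N.+1) accept c rho).
  by rewrite sumr_const card_ord mulr_natl.
rewrite (eq_bigr _ (fun k0 _ => acceptE_at k0)) exchange_big /=; apply: eq_bigr => f _.
rewrite -mulr_sumr -mulr_sumr; congr (_ * (_ * _)).
rewrite big_split /= -mulr_suml -natr_sum sumrB; congr (_ - _ + _).
  by rewrite sumr_const card_ord.
by rewrite -natr_sum.
Qed.

Hypothesis D_ge2 : (2 <= D)%N.

Lemma sum_wt (F : nat -> R) :
  \sum_(f : pat) F (wt f) =
  \sum_(j < N.+2) F j *+ #|[pred f | wt f == j]|.
Proof.
rewrite (partition_big (fun f => inord (wt f) : 'I_N.+2) predT) //=.
apply: eq_bigr => j _; rewrite -sumr_const; apply: eq_big => f.
  by rewrite inE -val_eqE /= inordK // ltnS wt_le.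
by rewrite -val_eqE /= inordK ?ltnS ?wt_le // => /eqP->.
Qed.

Lemma card_wt_gt0 (j : nat) : (j <= N.+1)%N -> (0 < #|[pred f | wt f == j]|)%N.
Proof.
move=> j_le; apply/card_gt0P; exists [ffun k : 'I_N.+1 => (k < j)%N].
rewrite inE /wt (eq_bigr (fun k : 'I_N.+1 => if (k < j)%N then 1%N else 0%N)).
  by rewrite -big_mkcond /= -(big_ord_widen _ (fun=> 1%N) j_le) sum1_card card_ord.
by move=> k _; rewrite ffunE; case: (k < j)%N.
Qed.

(** The state is a combination of pattern projectors: [W j] is shared equally among the patterns of
    level [j], then divided by the trace [(D - 1) ^ j] of each projector, which [D >= 2] keeps
    positive. *)
Lemma exists_level_state (W : nat -> R) :
  (forall j, 0 <= W j) -> \sum_(j < N.+2) W j = 1 ->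
  exists rho, [/\ density rho, perm_invariant rho &
    forall c, N.+1%:R * accept c rho = \sum_(j < N.+2) W j * level c j].
Proof.
move=> W_ge0 sumW.
have D1_gt0 : 0 < D%:R - 1 :> R by rewrite subr_gt0 ltr1n.
pose w j : R := W j / #|[pred f | wt f == j]|%:R.
have sum_w (F : nat -> R) :
    \sum_(f : pat) w (wt f) * F (wt f) = \sum_(j < N.+2) W j * F j.
  rewrite (sum_wt (fun j => w j * F j)); apply: eq_bigr => j _.
  have := card_wt_gt0 j (ltn_ord j); rewrite -(ltr0n R) => card_gt0.
  by rewrite -mulr_natr /w; field; rewrite gt_eqF.
pose e j : R := w j / (D%:R - 1) ^+ j.
pose rho := \sum_(f : pat) (e (wt f))%:C *: pattern_proj Psi f.
have e_ge0 j : 0 <= e j by rewrite !divr_ge0 ?ler0n ?exprn_ge0 ?W_ge0 // ltW.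
have tr_proj f : \tr (pattern_proj Psi f) = ((D%:R - 1) ^+ wt f)%:C.
  rewrite tr_tens /wt -prodrXr rmorph_prod; apply: eq_bigr => k _.
  by rewrite tr_local_proj //; case: (f k); rewrite ?expr1 ?expr0 // rmorphB rmorph_nat rmorph1.
have weight_rho f : weight Psi rho f = w (wt f).
  rewrite /weight mulmx_sumr [\tr _]linear_sum /= (bigD1 f) //= big1 => [|g neq].
    rewrite -scalemxAr linearZ /= tr_pattern_projM // eqxx addr0 ReZ.
    by rewrite tr_proj /e /= divfK // expf_neq0 // gt_eqF.
  by rewrite -scalemxAr linearZ /= tr_pattern_projM // eq_sym (negPf neq) mulr0.
have inv_rho : perm_invariant rho.
  move=> s; rewrite mulmx_sumr mulmx_suml.
  have inj_s : injective (fun f : pat => [ffun k => f (s k)] : pat).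
    by move=> f g /ffunP eqfg; apply/ffunP=> k; have := eqfg (s^-1%g k); rewrite !ffunE permKV.
  rewrite [RHS](reindex_inj inj_s); apply: eq_bigr => f _ /=.
  rewrite wt_perm -scalemxAr -scalemxAl permop_tens; congr (_ *: (_ *m _)).
  by apply: eq_tens => k; rewrite ffunE.
exists rho; split=> //; last first.
  by move=> c; rewrite accept_avg //; under eq_bigr do rewrite weight_rho; rewrite sum_w.
split; first split.
- rewrite /rho /adj raddf_sum /= [in RHS]raddf_sum; apply: eq_bigr => f _.
  by rewrite -[RHS]/(adj _) adjZ adj_pattern_proj.
- move=> v; rewrite mulmx_sumr mulmx_suml summxE; apply: sumr_ge0 => f _.
  have [_ proj_ge0] := psd_pattern_proj Psi Psi1 f.
  rewrite -scalemxAr -scalemxAl mxE mulr_ge0 ?proj_ge0 //.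
  by rewrite lecE /= eqxx e_ge0.
- rewrite [\tr _]linear_sum /= -[1]/(1%:C) -sumW.
  have := sum_w (fun=> 1); rewrite -!mulr_suml !mulr1 => <-.
  rewrite rmorph_sum; apply: eq_bigr => f _.
  by rewrite linearZ /= tr_proj -rmorphM /e divfK // expf_neq0 // gt_eqF.
Qed.

End Levels.

(** * Lines through consecutive level points in the plane of p and f - F p *)

Section Bound.
Context {R : realType} (eps del lam : R).
Hypotheses (eps01 : 0 < eps < 1) (del01 : 0 < del < 1) (lam01 : 0 < lam < 1).
Local Notation Nt := (Ntil eps del lam).
Local Notation a := ((1 - eps) * (1 - lam) + lam).

Let lam_gt0 : 0 < lam. Proof. by case/andP: lam01. Qed.
Let lam_neq0 : lam != 0. Proof. by rewrite gt_eqF. Qed.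
Let lam_lt1 : lam < 1. Proof. by case/andP: lam01. Qed.
Let nu_gt0 : 0 < 1 - lam. Proof. by rewrite subr_gt0; case/andP: lam01. Qed.
Let del_gt0 : 0 < del. Proof. by case/andP: del01. Qed.
Let del_lt1 : del < 1. Proof. by case/andP: del01. Qed.
Let F_gt0 : 0 < 1 - eps. Proof. by rewrite subr_gt0; case/andP: eps01. Qed.
Let eps_gt0 : 0 < eps. Proof. by case/andP: eps01. Qed.

(* In the (p, f - F p)-plane the line through the levels [k] and [k.+1] has slope
   [rise N k / ((1 - lam) (N lam + k (1 - lam)))]. *)
Definition rise (N k : nat) : R :=
  eps * lam * N.+1%:R * (1 - lam) - k%:R * a * (1 - lam) + lam * a.

(** [Ntil k] is the value of [N] at which the line through levels [k] and [k.+1] has height 0 at p =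
    del: up to a positive factor this height is [del * rise N k - lam ^+ k.+1]. *)
Lemma Ntil_leE (N k : nat) : (Nt k%:Z <= N%:R) = (lam ^+ k.+1 <= del * rise N k).
Proof.
rewrite /Ntil ler_pdivrMr ?mulr_gt0 // -subr_ge0 -[RHS]subr_ge0.
rewrite -PoszD addn1 -exprnP -pmulrn; congr (0 <= _).
by rewrite /rise -natr1; ring.
Qed.

Lemma expr_lower (m : nat) : 1 - m%:R * (1 - lam) <= lam ^+ m.
Proof.
elim: m => [|m IHm]; first by rewrite mul0r subr0 expr0.
rewrite exprS -natr1; have := ler_wpM2l (ltW lam_gt0) IHm.
have : 0 <= m%:R * (1 - lam) ^+ 2 by rewrite mulr_ge0 ?ler0n ?sqr_ge0.
by lra.
Qed.

(** With m the distance from [j] to [k.+1], this is 1 - m (1 - lam) <= lam^m for [j <= k.+1] and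
    lam^m (1 + m (1 - lam)) <= 1 beyond. Equality at [j = k] and [j = k.+1] is what puts the line
    through those levels. *)
Lemma bernoulli_level (j k : nat) :
  lam ^+ j * (lam - (k%:R - j%:R) * (1 - lam)) <= lam ^+ k.+1.
Proof.
have high m : lam ^+ m * (1 + m%:R * (1 - lam)) <= 1.
  elim: m => [|m IHm]; first by rewrite mul0r addr0 expr0 mulr1.
  apply: le_trans IHm; rewrite exprSr -mulrA ler_wpM2l ?exprn_ge0 ?(ltW lam_gt0) //.
  have : 0 <= m%:R * (1 - lam) ^+ 2 by rewrite mulr_ge0 ?ler0n ?sqr_ge0.
  have : 0 <= (1 - lam) ^+ 2 by rewrite sqr_ge0.
  by rewrite -natr1; lra.
have [le_jk|lt_kj] := leqP j k.+1.
  rewrite -[in leRHS](subnKC le_jk) exprD ler_wpM2l ?exprn_ge0 ?(ltW lam_gt0) //.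
  apply: le_trans (expr_lower _); rewrite natrB // -natr1; lra.
rewrite -[j in lam ^+ j](subnKC (ltnW lt_kj)) exprD -mulrA.
rewrite -[leRHS]mulr1 ler_wpM2l ?exprn_ge0 ?(ltW lam_gt0) //.
apply: le_trans (high (j - k.+1)%N); rewrite ler_wpM2l ?exprn_ge0 ?(ltW lam_gt0) //.
by rewrite natrB 1?ltnW // -natr1; lra.
Qed.

(** The gap between the two sides is [N.+1] times the excess of [del * rise N k] over the left side
    of [bernoulli_level]. Geometrically, the line through levels [k] and [k.+1] is lowered in
    parallel until it vanishes at p = del. *)
Lemma level_above_line (N j k : nat) : Nt k%:Z <= N%:R ->
  rise N k * (level lam (N := N) 1 j - N.+1%:R * del) <=
  (1 - lam) * (N%:R * lam + k%:R * (1 - lam)) *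
    (level lam (N := N) 0 j - (1 - eps) * level lam (N := N) 1 j).
Proof.
rewrite Ntil_leE => /(le_trans (bernoulli_level j k)).
rewrite -(ler_pM2l (ltr0Sn R N)) -subr_ge0 => diff_ge0; rewrite -subr_ge0.
move: diff_ge0; congr (0 <= _); rewrite /level /rise -!natr1.
by field.
Qed.

(** Up to scaling, the left side is f - F p for the mixture of levels [k] and [k.+1] with p = del;
    its sign is decided by [Ntil_leE]. *)
Lemma chord_level (N k : nat) :
  (N.+1%:R * del - level lam (N := N) 1 k.+1) *
    (level lam (N := N) 0 k - (1 - eps) * level lam (N := N) 1 k) +
  (level lam (N := N) 1 k - N.+1%:R * del) *
    (level lam (N := N) 0 k.+1 - (1 - eps) * level lam (N := N) 1 k.+1) =
  N.+1%:R * lam ^+ k / lam * (del * rise N k - lam ^+ k.+1).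
Proof. by rewrite /level /rise -!natr1 !exprS; field. Qed.

(** * The criterion for F(N, del, lam) to reach 1 - eps *)

Context {D : nat} (Psi : 'cV[R[i]]_D).
Hypotheses (D_ge2 : (2 <= D)%N) (Psi1 : unit_vec Psi).

Lemma level0 (N : nat) c : level lam (N := N) c 0 = N.+1%:R.
Proof. by rewrite /level expr0 mul1r mul0r addr0 subr0. Qed.

Lemma level_top (N : nat) c : level lam (N := N) c N.+1 = N.+1%:R * (lam ^+ N * c).
Proof. by rewrite /level exprS; field. Qed.

(** [N > 0] matters at [k = 0]: without any test, levels 0 and 1 both have p = 1. *)
Lemma level_decr (N k : nat) : (0 < N)%N -> level lam (N := N) 1 k.+1 < level lam (N := N) 1 k.
Proof.
move=> N_gt0; rewrite -subr_gt0.
suff -> : level lam (N := N) 1 k - level lam (N := N) 1 k.+1 =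
    lam ^+ k / lam * ((1 - lam) * (N%:R * lam + k%:R * (1 - lam))).
  rewrite mulr_gt0 ?divr_gt0 ?exprn_gt0 // mulr_gt0 //.
  by rewrite ltr_pwDl ?mulr_gt0 ?ltr0n // mulr_ge0 ?ler0n ?ltW.
by rewrite /level exprS -!natr1; field.
Qed.

(** The case [k1 = k2] is allowed and provides states on a single level. *)
Lemma exists_two_level_state (N k1 k2 : nat) (t : R) :
  (k1 <= N.+1)%N -> (k2 <= N.+1)%N -> 0 <= t <= 1 ->
  exists rho : 'M[R[i]]_#|{: tidx D N.+1}|, [/\ density rho, perm_invariant rho &
    forall c, N.+1%:R * accept Psi lam c rho =
      t * level lam (N := N) c k1 + (1 - t) * level lam (N := N) c k2].
Proof.
move=> k1_le k2_le /andP[t_ge0 t_le1].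
pose W j := t * (j == k1)%:R + (1 - t) * (j == k2)%:R.
have pick k (F : nat -> R) : (k <= N.+1)%N -> \sum_(j < N.+2) (j == k :> nat)%:R * F j = F k.
  rewrite -ltnS => k_lt; rewrite (bigD1 (Ordinal k_lt)) //= eqxx mul1r big1 ?addr0 // => j.
  by rewrite -val_eqE /= => /negPf ->; rewrite mul0r.
have sumW (F : nat -> R) : \sum_(j < N.+2) W j * F j = t * F k1 + (1 - t) * F k2.
  under eq_bigr do rewrite mulrDl -!mulrA.
  by rewrite big_split /= -!mulr_sumr !pick.
have W_ge0 j : 0 <= W j by rewrite addr_ge0 ?mulr_ge0 ?ler0n ?subr_ge0.
have W_sum1 : \sum_(j < N.+2) W j = 1.
  by have := sumW (fun=> 1); rewrite -mulr_suml !mulr1 => ->; rewrite addrC subrK.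
have [rho [rhoD rhoP rhoE]] := exists_level_state Psi Psi1 lam lam_neq0 D_ge2 W W_ge0 W_sum1.
by exists rho; split=> // c; rewrite rhoE sumW.
Qed.

Lemma f_val_ge0 (N : nat) (rho : 'M[R[i]]_#|{: tidx D N.+1}|) :
  density rho -> perm_invariant rho -> 0 <= f_val Psi lam rho.
Proof.
move=> [rho_psd _] rhoP; rewrite f_valE -(pmulr_rge0 _ (ltr0Sn R N)).
rewrite accept_avg //; apply: sumr_ge0 => f _.
rewrite mulr_ge0 ?weight_ge0 // /level mul0r mulr0 addr0.
by rewrite mulr_ge0 ?exprn_ge0 ?(ltW lam_gt0) // subr_ge0 ler_nat wt_le.
Qed.

Lemma Fmin_geP (N : nat) : (0 < N)%N ->
  (1 - eps <= Fmin Psi N del lam <-> exists k : nat, Nt k%:Z <= N%:R).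
Proof.
move=> N_gt0; have M_gt0 := ltr0Sn R N.
have one01 : 0 <= (1 : R) <= 1 by rewrite ler01 lexx.
split=> [leF|[k leNt]].
  have admissible (rho : 'M[R[i]]_#|{: tidx D N.+1}|) : density rho -> perm_invariant rho ->
      del <= p_val Psi lam rho -> (1 - eps) * p_val Psi lam rho <= f_val Psi lam rho.
    move=> rhoD rhoP p_ge; rewrite -ler_pdivlMr ?(lt_le_trans del_gt0) //.
    apply: le_trans leF (ge_inf _ _); last by exists rho.
    (* [ge_inf] needs a lower bound of the ratios; 0 serves because f is nonnegative. *)
    exists 0 => _ [rho' [rhoD' [rhoP' p_ge']] <-].
    by rewrite divr_ge0 ?f_val_ge0 // (le_trans (ltW del_gt0)).
  (* The top level has f = 0, so with p >= del it would be an admissible state of ratio 0 < 1 -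
     eps. *)
  have top_lt : level lam (N := N) 1 N.+1 < N.+1%:R * del.
    rewrite ltNge; apply/negP => top_ge.
    have [rho [rhoD rhoP rhoE]] :=
      exists_two_level_state N N.+1 N.+1 1 (leqnn _) (leqnn _) one01.
    have p_eq : N.+1%:R * p_val Psi lam rho = level lam (N := N) 1 N.+1.
      by rewrite p_valE rhoE mul1r subrr mul0r addr0.
    have f_eq : N.+1%:R * f_val Psi lam rho = 0.
      by rewrite f_valE rhoE subrr mul0r addr0 level_top !mulr0.
    have := top_ge; rewrite -p_eq ler_pM2l // => p_ge.
    have := admissible _ rhoD rhoP p_ge; rewrite -(ler_pM2l M_gt0) f_eq leNgt.
    by rewrite !mulr_gt0 ?(lt_le_trans del_gt0 p_ge).
  (* The first level with p < del is not level 0, where p = 1, so it has the form [k.+1] and the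
     levels [k], [k.+1] enclose del. *)
  have [[|k] low_lt low_min] :=
    ex_minnP (ex_intro (fun j => level lam (N := N) 1 j < N.+1%:R * del) _ top_lt).
    by move: low_lt; rewrite level0 ltr_pMr // ltNge (ltW del_lt1).
  have k_le := low_min _ top_lt.
  have high_ge : N.+1%:R * del <= level lam (N := N) 1 k.
    by rewrite leNgt; apply/negP => /low_min; rewrite ltnn.
  have gap_gt0 : 0 < level lam (N := N) 1 k - level lam (N := N) 1 k.+1.
    by rewrite subr_gt0 level_decr.
  (* The weight of level [k] for which the mixture has p = del exactly. *)
  pose t := (N.+1%:R * del - level lam (N := N) 1 k.+1) /
    (level lam (N := N) 1 k - level lam (N := N) 1 k.+1).
  have t01 : 0 <= t <= 1.
    rewrite divr_ge0 ?subr_ge0 ?(ltW low_lt) ?(ltW gap_gt0) //=.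
      by rewrite ler_pdivrMr // mul1r lerD2r.
    by rewrite ltW // level_decr.
  have [rho [rhoD rhoP rhoE]] :=
    exists_two_level_state _ _ _ _ (ltnW k_le) k_le t01.
  have p_eq : p_val Psi lam rho = del.
    apply: (mulfI (lt0r_neq0 M_gt0)); rewrite p_valE rhoE /t; field.
    by rewrite lt0r_neq0.
  exists k; rewrite Ntil_leE -subr_ge0.
  have := admissible _ rhoD rhoP; rewrite p_eq lexx => /(_ isT).
  have Mp : N.+1%:R * del = t * level lam (N := N) 1 k + (1 - t) * level lam (N := N) 1 k.+1.
    by rewrite -p_eq p_valE rhoE.
  have Mf : N.+1%:R * f_val Psi lam rho =
      t * level lam (N := N) 0 k + (1 - t) * level lam (N := N) 0 k.+1.
    by rewrite f_valE rhoE.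
  rewrite -(ler_pM2l M_gt0) (mulrCA _ (1 - eps)) Mf Mp -subr_ge0.
  rewrite -(pmulr_rge0 _ gap_gt0).
  rewrite [leRHS](_ : _ = N.+1%:R * lam ^+ k / lam * (del * rise N k - lam ^+ k.+1)).
    by rewrite pmulr_rge0 // divr_gt0 // mulr_gt0 // exprn_gt0.
  by rewrite -chord_level /t; field; rewrite lt0r_neq0.
(* [lb_le_inf] asks for an admissible state; level 0 has p = 1. *)
apply: lb_le_inf => [|_ [rho [rhoD [rhoP p_ge]] <-]].
  have [rho [rhoD rhoP rhoE]] :=
    exists_two_level_state N 0 0 1 (leq0n _) (leq0n _) one01.
  exists (f_val Psi lam rho / p_val Psi lam rho), rho => //; do 2!split=> //.
  rewrite p_valE (_ : accept _ _ _ _ = 1) ?(ltW del_lt1) //.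
  by apply: (mulfI (lt0r_neq0 M_gt0)); rewrite rhoE level0 mul1r subrr mul0r addr0 mulr1.
have Mf : N.+1%:R * f_val Psi lam rho =
    \sum_f weight Psi rho f * level lam (N := N) 0 (wt f) by rewrite f_valE accept_avg.
have Mp : N.+1%:R * p_val Psi lam rho =
    \sum_f weight Psi rho f * level lam (N := N) 1 (wt f) by rewrite p_valE accept_avg.
move: (f_val Psi lam rho) (p_val Psi lam rho) p_ge Mf Mp => fv pv p_ge Mf Mp.
rewrite ler_pdivlMr ?(lt_le_trans del_gt0) // -subr_ge0.
have A_gt0 : 0 < (1 - lam) * (N%:R * lam + k%:R * (1 - lam)).
  by rewrite mulr_gt0 // ltr_pwDl ?mulr_gt0 ?ltr0n // mulr_ge0 ?ler0n ?ltW.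
(* With a nonnegative slope, the line vanishing at p = del is nonnegative wherever p >= del. *)
have rise_ge0 : 0 <= rise N k.
  rewrite -(pmulr_rge0 _ del_gt0); move: leNt; rewrite Ntil_leE; apply: le_trans.
  by rewrite exprn_ge0 ?ltW.
rewrite -(pmulr_rge0 _ A_gt0) -(pmulr_rge0 _ M_gt0).
apply: (@le_trans _ _ (rise N k * (N.+1%:R * (pv - del)))).
  by rewrite !mulr_ge0 ?ler0n ?subr_ge0.
have sum1 : \sum_f weight Psi rho f = 1 by apply: sum_weight => //; case: rhoD.
have -> : rise N k * (N.+1%:R * (pv - del)) =
    \sum_f weight Psi rho f * (rise N k * (level lam (N := N) 1 (wt f) - N.+1%:R * del)).
  under eq_bigr do rewrite mulrCA mulrBr.
  by rewrite -mulr_sumr sumrB -mulr_suml sum1 mul1r mulrBr Mp.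
rewrite [leRHS]mulrCA (mulrBr N.+1%:R) (mulrCA _ (1 - eps)) Mf Mp.
rewrite (mulr_sumr _ _ _ (1 - eps)) -sumrB mulr_sumr.
apply: ler_sum => f _; rewrite (mulrCA (1 - eps)) -mulrBr [leRHS]mulrCA.
by rewrite ler_wpM2l ?weight_ge0 ?level_above_line //; case: rhoD.
Qed.

(** * Minimisation of [Ntil] over k *)

Lemma lam_lt_a : lam < a.
Proof. by rewrite ltrDr mulr_gt0. Qed.

(** Together with [lam_lt_a] this places the threshold [lam ^ k / a] strictly between [lam ^ k] and
    [lam ^ (k - 1)], so only the two roundings of the logarithm compete. *)
Lemma a_lt1 : a < 1.
Proof. by rewrite -subr_gt0 (_ : 1 - a = eps * (1 - lam)) ?mulr_gt0 //; ring. Qed.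

Let a_gt0 : 0 < a. Proof. exact: lt_trans lam_lt_a. Qed.

Lemma exprz_decr (j k : int) : k <= j -> lam ^ j <= lam ^ k.
Proof.
rewrite -subr_ge0; case E: (j - k) => [n|//] _.
rewrite -[j](subrK k) E addrC expfzDr // ler_piMr ?exprz_ge0 ?(ltW lam_gt0) //.
by rewrite exprn_ile1 ?(ltW lam_gt0) // -subr_ge0 ltW.
Qed.

(** Positivity makes the requirement N >= 1 automatic. *)
Lemma Ntil_gt0 (k : nat) : 0 < Nt k%:Z.
Proof.
rewrite /Ntil divr_gt0 ?mulr_gt0 // -PoszD addn1 -exprnP -pmulrn (exprS lam).
have gap_gt0 : 0 < lam ^+ k - del * (1 - k%:R * (1 - lam)).
  have [knu_le1|knu_gt1] := leP (k%:R * (1 - lam)) 1.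
    (* Where Bernoulli's inequality is an equality, strictness comes from [del < 1]. *)
    rewrite subr_gt0; have := expr_lower k; rewrite le_eqVlt => /predU1P[->|].
      by rewrite gtr_pMl ?exprn_gt0.
    by apply: le_lt_trans; rewrite ler_piMl ?subr_ge0 // ltW.
  rewrite subr_gt0 (@lt_trans _ _ 0) ?exprn_gt0 //.
  by rewrite pmulr_rlt0 // subr_lt0.
rewrite -addrA ltr_wpDl ?mulr_ge0 ?ler0n ?exprn_ge0 ?ltW //.
rewrite [ltRHS](_ : _ = lam * (lam ^+ k - del * (1 - k%:R * (1 - lam)))) ?mulr_gt0 //.
by ring.
Qed.

(** The difference grows with [k] because [lam ^ k] decreases, so [Nt] is convex on the integers. *)
Lemma Ntil_step (k : int) :
  Nt k - Nt (k - 1) = (del * a - lam ^ k) / (lam * del * eps).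
Proof.
rewrite /Ntil subrK expfzDr // expr1z rmorphB /=; field.
by rewrite !gt_eqF.
Qed.

Lemma Ntil_le_pred (k : int) : (Nt k <= Nt (k - 1)) = (del <= lam ^ k / a).
Proof.
rewrite -subr_le0 Ntil_step ler_pdivlMr // pmulr_lle0 ?subr_le0 //.
by rewrite invr_gt0 !mulr_gt0.
Qed.

Lemma Ntil_pred_le (k : int) : (Nt (k - 1) <= Nt k) = (lam ^ k / a <= del).
Proof.
rewrite -subr_ge0 Ntil_step ler_pdivrMr // pmulr_lge0 ?subr_ge0 //.
by rewrite invr_gt0 !mulr_gt0.
Qed.

(** The hypotheses say that [Nt] does not increase in the step into [kstar] and does not decrease in
    the step out of it; convexity extends this to all further steps. *)
Lemma Ntil_min (kstar : int) :
  del <= lam ^ kstar / a -> lam ^ (kstar + 1) / a <= del -> forall k, Nt kstar <= Nt k.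
Proof.
move=> le_star ge_star k.
have up (n : nat) : Nt kstar <= Nt (kstar + n%:Z).
  elim: n => [|n /le_trans]; first by rewrite addr0.
  apply; rewrite -addn1 PoszD addrA -[X in Nt X <= _](addrK 1) Ntil_pred_le.
  apply: le_trans ge_star; rewrite ler_pM2r ?invr_gt0 // exprz_decr //.
  by rewrite lerD2r lerDl.
have down (n : nat) : Nt kstar <= Nt (kstar - n%:Z).
  elim: n => [|n /le_trans]; first by rewrite subr0.
  apply; rewrite -addn1 PoszD opprD addrA Ntil_le_pred.
  by apply: le_trans le_star _; rewrite ler_pM2r ?invr_gt0 // exprz_decr // gerBl.
case/intP: (k - kstar) (subrK kstar k) => [|n|n] <-; rewrite addrC; first by rewrite addr0.
  exact: up.
exact: down.
Qed.

(** Minimality of [kstar] turns the existential criterion of [Fmin_geP] into the single inequality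
    [Nt kstar <= N]. *)
Lemma Ntests_ceil (kstar : nat) :
  (forall k : nat, Nt kstar%:Z <= Nt k%:Z) ->
  (Ntests Psi eps del lam)%:Z = Num.ceil (Nt kstar%:Z).
Proof.
move=> min_star.
have validP (N : nat) : (1 <= N)%N && (1 - eps <= Fmin Psi N del lam) = (Nt kstar%:Z <= N%:R).
  apply/andP/idP => [[N_gt0 /(Fmin_geP _ N_gt0)[k]]|le_N]; first exact: le_trans.
  have N_gt0 : (0 < N)%N by rewrite -(ltr0n R) (lt_le_trans (Ntil_gt0 kstar)).
  by split=> //; apply/(Fmin_geP _ N_gt0); exists kstar.
have ceil_gt0 : 0 < Num.ceil (Nt kstar%:Z) by rewrite ceil_gt0 Ntil_gt0.
case E: (Num.ceil _) ceil_gt0 => [n|//] _.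
have ceilP (N : nat) : (Nt kstar%:Z <= N%:R) = (n <= N)%N.
  by rewrite -lez_nat -E ceil_le_int.
(* The default value 0 is excluded, since the ceiling [n] is itself a valid number of tests. *)
rewrite /Ntests; case: pselect => [ex|[]]; last by exists n; rewrite validP ceilP.
case: ex_minnP => m; rewrite validP ceilP => le_nm /(_ n).
by rewrite validP ceilP leqnn => /(_ isT) le_mn; congr Posz; apply/eqP; rewrite eqn_leq le_mn.
Qed.

(** * Powers of [lam] compared with del through the logarithm *)

Lemma log_leE (n : nat) : (lam ^+ n <= del) = (ln del / ln lam <= n%:R).
Proof.
have ln_lt0 : ln lam < 0 by rewrite ln_lt0.
by rewrite ler_ndivrMr // -ler_ln ?posrE ?exprn_gt0 // lnXn // mulr_natl.
Qed.

Lemma log_geE (n : nat) : (del <= lam ^+ n) = (n%:R <= ln del / ln lam).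
Proof.
have ln_lt0 : ln lam < 0 by rewrite ln_lt0.
by rewrite ler_ndivlMr // -ler_ln ?posrE ?exprn_gt0 // lnXn // mulr_natl.
Qed.

Let log_gt0 : 0 < ln del / ln lam.
Proof. by rewrite nmulr_rgt0 ?invr_lt0 ln_lt0. Qed.

Lemma kminus_ge0 : 0 <= kminus del lam.
Proof. by rewrite floor_ge0 ltW. Qed.

Lemma kplus_ge0 : 0 <= kplus del lam.
Proof. by rewrite ltW // ceil_gt0. Qed.

Lemma expr_kminus : del <= lam ^ kminus del lam.
Proof.
have := kminus_ge0; rewrite /kminus; case E: (Num.floor _) => [n|//] _.
by rewrite -exprnP log_geE -[n%:R]/((n%:Z)%:~R) -E floor_le.
Qed.

Lemma expr_kplus : lam ^ kplus del lam <= del.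
Proof.
have := kplus_ge0; rewrite /kplus; case E: (Num.ceil _) => [n|//] _.
by rewrite -exprnP log_leE -[n%:R]/((n%:Z)%:~R) -E ceil_ge.
Qed.

Lemma kplus_kminus :
  kplus del lam = kminus del lam \/ kplus del lam = kminus del lam + 1.
Proof.
by rewrite /kplus /kminus ceil_floor; case: (_ \isn't a _); [right|left; rewrite addr0].
Qed.

End Bound.

Theorem theorem2 (R : realType) (D : nat) (Psi : 'cV[R[i]]_D) (eps del lam : R) :
  (2 <= D)%N -> unit_vec Psi ->
  0 < eps < 1 -> 0 < del < 1 -> 0 < lam < 1 ->
  let Nv := Ntests Psi eps del lam in
  let Nt := Ntil eps del lam in
  let kp := kplus del lam in
  let km := kminus del lam in
  (* the minimum over k in Z_{>=0} of \tilde N exists *)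
  (exists k0 : nat, forall k : nat, Nt k0%:Z <= Nt k%:Z) /\
  Nv%:Z = Num.ceil (inf (range (fun k : nat => Nt k%:Z))) /\
  (exists kstar : int,
     (0 <= kstar)%R /\
     del <= lam ^ kstar / ((1 - eps) * (1 - lam) + lam) /\
     (forall k : int, del <= lam ^ k / ((1 - eps) * (1 - lam) + lam) -> k <= kstar) /\
     (1 - eps) * (1 - lam) + lam = (1 - eps) + lam * eps /\
     Nv%:Z = Num.ceil (Nt kstar) /\
     (kstar = kp \/ kstar = km)) /\
  Nv%:Z = Num.ceil (Num.min (Nt kp) (Nt km)) /\
  (lam ^ kp / ((1 - eps) + lam * eps) <= del -> Nv%:Z = Num.ceil (Nt km)) /\
  (del <= lam ^ kp / ((1 - eps) + lam * eps) -> Nv%:Z = Num.ceil (Nt kp)).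
Proof.
move=> D_ge2 Psi1 eps01 del01 lam01 Nv Nt kp km.
have lam_gt0 : 0 < lam by case/andP: lam01.
have del_gt0 : 0 < del by case/andP: del01.
have aE : (1 - eps) * (1 - lam) + lam = (1 - eps) + lam * eps by ring.
have lam_lt_a := lam_lt_a eps lam eps01 lam01.
have a_lt1 := a_lt1 eps lam eps01 lam01.
set a := (1 - eps) * (1 - lam) + lam in lam_lt_a a_lt1 *.
rewrite -aE -/a; have a_gt0 : 0 < a := lt_trans lam_gt0 lam_lt_a.
have decr : forall j k : int, k <= j -> lam ^ j <= lam ^ k := exprz_decr lam lam01.
have kp_le : lam ^ kp <= del := expr_kplus del lam del01 lam01.
have km_ge : del <= lam ^ km := expr_kminus del lam del01 lam01.
have kp_ge0 : 0 <= kp := kplus_ge0 del lam del01 lam01.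
have km_ge0 : 0 <= km := kminus_ge0 del lam del01 lam01.
have kpm : kp = km \/ kp = km + 1 := kplus_kminus del lam.
have optimal kstar : 0 <= kstar -> del <= lam ^ kstar / a -> lam ^ (kstar + 1) / a <= del ->
    (forall k, Nt kstar <= Nt k) /\ Nv%:Z = Num.ceil (Nt kstar).
  move=> star_ge0 le_star ge_star.
  have min_star := Ntil_min eps del lam eps01 del01 lam01 kstar le_star ge_star.
  split=> //; case: kstar star_ge0 {le_star ge_star} min_star => // n _ min_n.
  exact: (Ntests_ceil eps del lam eps01 del01 lam01 Psi D_ge2 Psi1).
(* [lam ^ (kp + 1) <= lam * del < a * del], so the threshold condition fails beyond [kp]. *)
have kp_next : lam ^ (kp + 1) / a < del.
  rewrite ltr_pdivrMr // expfzDr ?gt_eqF // expr1z.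
  apply: (@le_lt_trans _ _ (del * lam)); first by rewrite ler_pM2r.
  by rewrite ltr_pM2l.
have km_low : del <= lam ^ km / a.
  by rewrite ler_pdivlMr // (le_trans _ km_ge) // ler_piMr // ltW.
have km_next : lam ^ kp / a <= del -> lam ^ (km + 1) / a <= del.
  apply: le_trans; rewrite ler_pM2r ?invr_gt0 // decr //.
  by case: kpm => ->; rewrite ?lerDl.
have casep : del <= lam ^ kp / a -> (forall k, Nt kp <= Nt k) /\ Nv%:Z = Num.ceil (Nt kp).
  by move=> le_kp; apply: optimal => //; rewrite ltW.
have casem : lam ^ kp / a <= del -> (forall k, Nt km <= Nt k) /\ Nv%:Z = Num.ceil (Nt km).
  by move=> ge_kp; apply: optimal => //; exact: km_next.
(* The inequality at [kstar + 1] is strict so that [kstar] is the largest admissible exponent; at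
   the tie [del = lam ^ kp / a] the choice is [kp]. *)
have [kstar [star_ge0 le_star ge_star star_pm]] : exists kstar,
    [/\ 0 <= kstar, del <= lam ^ kstar / a, lam ^ (kstar + 1) / a < del
      & kstar = kp \/ kstar = km].
  have [le_kp|lt_kp] := leP del (lam ^ kp / a).
    by exists kp; split=> //; left.
  exists km; split=> //; last by right.
  apply: le_lt_trans lt_kp; rewrite ler_pM2r ?invr_gt0 // decr //.
  by case: kpm => ->; rewrite ?lerDl.
have [min_star Nv_star] := optimal _ star_ge0 le_star (ltW ge_star).
have star_n : kstar = `|kstar|%N by rewrite gez0_abs.
set n := `|kstar|%N in star_n.
split; first by exists n => k; rewrite -star_n.
split.
  rewrite Nv_star; congr Num.ceil; apply/eqP; rewrite eq_le; apply/andP; split.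
    by apply: lb_le_inf => [|_ [k _ <-]]; first by exists (Nt 0%:Z), 0%N.
  apply: ge_inf; last by exists n; rewrite // star_n.
  by exists (Nt kstar) => _ [k _ <-].
split.
  exists kstar; do !split=> //.
  move=> k le_k; rewrite leNgt -lezD1; apply/negP => lt_k.
  move: ge_star; rewrite ltNge => /negP; apply; apply: le_trans le_k _.
  by rewrite ler_pM2r ?invr_gt0 // decr.
split; last by split=> [/casem[]|/casep[]].
(* [kstar] minimises over all integers and is one of [kp], [km], hence it attains the minimum of the
   two. *)
rewrite Nv_star; congr Num.ceil; apply/eqP; rewrite eq_le le_min !min_star /=.
by rewrite ge_min; case: star_pm => ->; rewrite lexx ?orbT.
Qed.
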